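(* Let $\mathcal{S}$ be an anti-negative semifield, let $n$ be a positive integer, and let $T:M_n(\mathcal{S})\to M_n(\mathcal{S})$ be a bijective $\mathcal{S}$-linear transformation. Then the following are equivalent: (i) $T$ preserves $\mathcal{R}$; (ii) $T$ preserves $\mathcal{L}$; (iii) $T$ preserves $\le_{\mathcal{R}}$; (iv) $T$ preserves $\le_{\mathcal{L}}$; (v) there exist invertible (monomial) matrices $P,Q\in M_n(\mathcal{S})$ such that $T(X)=PXQ$ for all $X\in M_n(\mathcal{S})$.
   Context: A semiring is a set $\mathcal{S}$ with addition and multiplication such that $\mathcal{S}$ is a commutative monoid under addition with identity $0_{\mathcal{S}}$, a semigroup under multiplication, multiplication distributes over addition on both sides, and $s0_{\mathcal{S}}=0_{\mathcal{S}}s=0_{\mathcal{S}}$ for all $s$. It is a semifield if $\mathcal{S}\setminus\{0_{\mathcal{S}}\}$ is an abelian group under multiplication (with identity $1_{\mathcal{S}}$). It is anti-negative if $a+b=0_{\mathcal{S}}$ implies $a=b=0_{\mathcal{S}}$. $M_n(\mathcal{S})$ is the set of $n\times n$ matrices over $\mathcal{S}$, viewed as a monoid under matrix multiplication and as an $\mathcal{S}$-module entrywise. $\mathcal{S}$-linear means additive and compatible with scalar multiplication. In the monoid $\mathcal{M}=M_n(\mathcal{S})$: $a\le_{\mathcal{R}} b$ iff there is $s\in\mathcal{M}$ with $a=bs$; $a\le_{\mathcal{L}} b$ iff there is $s\in\mathcal{M}$ with $a=sb$; $a\,\mathcal{R}\,b$ iff $a\le_{\mathcal{R}}b$ and $b\le_{\mathcal{R}}a$;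 $a\,\mathcal{L}\,b$ iff $a\le_{\mathcal{L}}b$ and $b\le_{\mathcal{L}}a$. $T$ preserves a relation $\mathcal{P}$ if $A\,\mathcal{P}\,B$ implies $T(A)\,\mathcal{P}\,T(B)$ for all $A,B\in M_n(\mathcal{S})$. A monomial matrix is one with exactly one non-zero entry in each row and in each column; over an anti-negative semifield the invertible matrices in $M_n(\mathcal{S})$ are precisely the monomial ones. *)

(* Defs.v *)
From HB Require Import structures.
From mathcomp Require Import all_boot all_order all_algebra.

Set Implicit Arguments.
Unset Strict Implicit.
Unset Printing Implicit Defensive.

Import GRing.Theory.
Local Open Scope ring_scope.

(* A [comNzSemiRingType] has [1 != 0], so that, given inverses, the nonzero
   elements are closed under multiplication and form an abelian group.
   Conversely, if they form an abelian group with unit 1, then multiplication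
   is commutative with unit 1 on all of S because 0 is absorbing. *)
Definition semifield (S : comNzSemiRingType) : Prop :=
  forall x : S, x != 0 -> exists y : S, x * y = 1.

Definition anti_negative (S : comNzSemiRingType) : Prop :=
  forall a b : S, a + b = 0 -> a = 0 /\ b = 0.

Section MatrixMonoid.

Variables (S : comNzSemiRingType) (n : nat).
Implicit Types A B P : 'M[S]_n.

Definition le_R A B : Prop := exists X : 'M[S]_n, A = B *m X.
Definition le_L A B : Prop := exists X : 'M[S]_n, A = X *m B.
Definition green_R A B : Prop := le_R A B /\ le_R B A.
Definition green_L A B : Prop := le_L A B /\ le_L B A.

Definition preserves (T : 'M[S]_n -> 'M[S]_n)
    (rel : 'M[S]_n -> 'M[S]_n -> Prop) : Prop :=
  forall A B, rel A B -> rel (T A) (T B).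

(* [unitmx] needs a ring of coefficients, hence this direct definition. *)
Definition invertible_mx P : Prop :=
  exists B : 'M[S]_n, P *m B = 1%:M /\ B *m P = 1%:M.

Definition monomial_mx P : Prop :=
  (forall i, exists! j, P i j != 0) /\ (forall j, exists! i, P i j != 0).

End MatrixMonoid.

(* Main.v *)
Require Import Defs.
From HB Require Import structures.
From mathcomp Require Import all_boot all_order all_algebra.

Set Implicit Arguments.
Unset Strict Implicit.
Unset Printing Implicit Defensive.

Import GRing.Theory.
Local Open Scope ring_scope.

(** A surjective linear map on matrices over an anti-negative semifield cannot
    create zeros by cancellation, so it merely permutes and rescales the
    entries: [T X i j = c i j * X (tau (i, j))] with [c] nowhere zero and [tau]
    a bijection on positions ([linear_surj_monomial]).

    Suppose that [T] preserves Green's relation R. All matrices [u v] of rank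
    one with a fixed column [u] (and a row [v] containing a 1) are R-related,
    so their images under [T] are R-related as well, and testing this on a few
    such pairs determines [tau] and [c].
    - If [u] is a basis vector, the image of [u e_s] lives in a single row, so
      the image of [u (1 ... 1)] lives in that row too: [tau] sends rows to
      rows.
    - If [u = (1 ... 1)], the image of [u (1 ... 1)] has no zero entry. A
      combination of its columns with a zero entry is therefore zero, by
      anti-negativity; since the columns of [T (u e_s)] are such combinations,
      each of them is zero or nowhere zero: [tau] sends columns to columns.
    - Still with [u = (1 ... 1)], the image of [u e_s] now has only one nonzero
      column, and all columns of [c], which is the image of [u (1 ... 1)], are
      multiples of it: [c i j = p i * q j].
    Hence [T X i j = p i * X (alpha i) (beta j) * q j] with [alpha] and [beta]
    bijective, which is [P *m X *m Q] for two monomial matrices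
    ([preserves_green_R_monomial]). The case of L follows by transposition, and
    maps [X |-> P *m X *m Q] with [P] and [Q] invertible preserve all four
    relations. *)

(** * Anti-negative semifields *)

Section Semifield.

Variables (S : comNzSemiRingType).
Hypotheses (semifieldS : semifield S) (anti_negS : anti_negative S).

Lemma semifield_mulf_eq0 (x y : S) : x * y = 0 -> x != 0 -> y = 0.
Proof.
move=> xy0 /semifieldS[z xz1].
by rewrite -[y]mul1r -xz1 [x * z]mulrC -mulrA xy0 mulr0.
Qed.

Lemma anti_negative_sum_eq0 (I : finType) (F : I -> S) :
  \sum_i F i = 0 -> forall i, F i = 0.
Proof. by move=> sumF0 i; move: sumF0; rewrite (bigD1 i) //= => /anti_negS[]. Qed.

(** * Surjective linear maps on matrices are monomial *)

Section Monomial.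

Variable n : nat.
Implicit Types (p q : 'I_n * 'I_n) (X : 'M[S]_n).

Let E p : 'M[S]_n := delta_mx p.1 p.2.

Lemma linear_deltaE (T : {linear 'M[S]_n -> 'M[S]_n}) X i j :
  T X i j = \sum_p X p.1 p.2 * T (E p) i j.
Proof.
rewrite {1}[X]matrix_sum_delta pair_bigA linear_sum summxE.
by apply: eq_bigr => p _; rewrite linearZ mxE.
Qed.

(** When [E q] is written as [T X], that is, as a combination of the [T (E p)],
    nothing cancels; so any [T (E p)] that contributes to the entry [q] vanishes
    at all other entries. The choice of such a [p] for each [q] is injective,
    hence exhausts all positions [p]. *)
Lemma linear_surj_monomial (T : {linear 'M[S]_n -> 'M[S]_n}) :
    (forall Y, exists X, T X = Y) ->
  exists (c : 'I_n -> 'I_n -> S) (tau : 'I_n * 'I_n -> 'I_n * 'I_n),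
    [/\ forall i j, c i j != 0, injective tau
      & forall X i j, T X i j = c i j * X (tau (i, j)).1 (tau (i, j)).2].
Proof.
move=> surjT.
have /fin_all_exists[tau tauP] q : exists p, T (E p) q.1 q.2 != 0 /\
    forall q', q' != q -> T (E p) q'.1 q'.2 = 0.
  have [X TX] := surjT (E q).
  have [p Xp_neq0] : exists p, X p.1 p.2 * T (E p) q.1 q.2 != 0.
    apply/existsP; rewrite -negb_forall; apply/forallP => all0.
    have := oner_neq0 S; have <- : T X q.1 q.2 = 1 by rewrite TX mxE !eqxx.
    by rewrite linear_deltaE big1 ?eqxx // => p _; apply/eqP/all0.
  exists p; split; first by apply: contraNneq Xp_neq0 => ->; rewrite mulr0.
  move=> q' q'_neq; apply: (@semifield_mulf_eq0 (X p.1 p.2)); last first.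
    by apply: contraNneq Xp_neq0 => ->; rewrite mul0r.
  have TXq' : T X q'.1 q'.2 = 0.
    by rewrite TX mxE -xpair_eqE -!surjective_pairing (negPf q'_neq).
  by move: TXq'; rewrite linear_deltaE => /anti_negative_sum_eq0/(_ p).
have tau_inj : injective tau.
  move=> q q' tau_eq; apply/eqP; apply: contraT => q_neq.
  have [_ /(_ q q_neq)] := tauP q'; rewrite -tau_eq => Tq0.
  by have [] := tauP q; rewrite Tq0 eqxx.
exists (fun i j => T (E (tau (i, j))) i j), tau; split=> // [i j|X i j].
  by have [] := tauP (i, j).
rewrite linear_deltaE (bigD1 (tau (i, j))) //= big1 ?addr0 1?mulrC // => p.
rewrite -(f_invF tau_inj p) (inj_eq tau_inj) eq_sym => q_neq.
by have [_ /(_ _ q_neq)/= ->] := tauP (invF tau_inj p); rewrite mulr0.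
Qed.

End Monomial.

(** * Matrices with one nonzero entry in each row and column *)

Section MonomialMatrix.

Variable n : nat.
Implicit Types (d : 'I_n -> S) (f : 'I_n -> 'I_n).

Definition scaled_perm_mx d f : 'M[S]_n := \matrix_(i, j) (d i *+ (j == f i)).

Lemma mul_scaled_perm_mx d f (X : 'M[S]_n) i j :
  (scaled_perm_mx d f *m X) i j = d i * X (f i) j.
Proof.
rewrite mxE (bigD1 (f i)) //= big1 ?addr0 => [|k /negPf k_neq].
  by rewrite mxE eqxx.
by rewrite mxE k_neq mul0r.
Qed.

Lemma mul_mx_tr_scaled_perm_mx d f (X : 'M[S]_n) i j :
  (X *m (scaled_perm_mx d f)^T) i j = X i (f j) * d j.
Proof.
rewrite mxE (bigD1 (f j)) //= big1 ?addr0 => [|k /negPf k_neq].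
  by rewrite !mxE eqxx.
by rewrite !mxE k_neq mulr0.
Qed.

Lemma monomial_scaled_perm_mx d f :
  (forall i, d i != 0) -> injective f -> monomial_mx (scaled_perm_mx d f).
Proof.
move=> d_neq0 f_inj.
have entry i j : (scaled_perm_mx d f i j != 0) = (j == f i).
  by rewrite mxE; case: (j == f i); rewrite ?mulr1n ?mulr0n ?eqxx ?d_neq0.
split=> [i|j].
  by exists (f i); split=> [|j]; rewrite entry // => /eqP.
exists (invF f_inj j); split=> [|i]; rewrite entry ?f_invF // => /eqP->.
exact: invF_f.
Qed.

Lemma invertible_scaled_perm_mx d f :
  (forall i, d i != 0) -> injective f -> invertible_mx (scaled_perm_mx d f).
Proof.
move=> d_neq0 f_inj.
have /fin_all_exists[e de] i : exists e, d i * e = 1 by exact: semifieldS.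
pose g := invF f_inj.
exists (scaled_perm_mx (fun i => e (g i)) g).
split; apply/matrixP=> i j; rewrite mul_scaled_perm_mx !mxE.
  by rewrite /g invF_f mulrnAr de eq_sym.
by rewrite mulrnAr [e _ * _]mulrC de /g f_invF eq_sym.
Qed.

Lemma invertible_mx_tr (A : 'M[S]_n) : invertible_mx A -> invertible_mx A^T.
Proof. by case=> B [AB BA]; exists B^T; rewrite -!trmx_mul AB BA trmx1. Qed.

Lemma monomial_mx_tr (A : 'M[S]_n) : monomial_mx A -> monomial_mx A^T.
Proof.
move=> [rowA colA]; split=> k.
  by have [l [Al Aun]] := colA k; exists l; split=> [|l']; rewrite mxE //; exact: Aun.
by have [l [Al Aun]] := rowA k; exists l; split=> [|l']; rewrite mxE //; exact: Aun.
Qed.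

End MonomialMatrix.

(** * Linear maps that preserve R *)

Section PreservesR.

Variable n : nat.
Hypothesis n_gt0 : (0 < n)%N.

Let outer (u v : 'I_n -> S) : 'M[S]_n := \matrix_(i, j) (u i * v j).

(** The column of [outer u w] at [s] is [u] itself, and every column of
    [outer u v] is a multiple of [u]. These rank one matrices are the only ones
    on which the preservation of R has to be tested. *)
Lemma le_R_outer u v w s : w s = 1 -> le_R (outer u v) (outer u w).
Proof.
move=> ws; exists (\matrix_(k, j) (v j *+ (k == s))); apply/matrixP=> i j.
rewrite !mxE (bigD1 s) //= big1 => [|k /negPf k_neq].
  by rewrite !mxE ws eqxx mulr1 addr0.
by rewrite !mxE k_neq mulr0.
Qed.

Lemma green_R_outer u v w s t :
  v t = 1 -> w s = 1 -> green_R (outer u v) (outer u w).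
Proof. by move=> vt ws; split; [exact: le_R_outer ws | exact: le_R_outer vt]. Qed.

(** Below, [e s] is a basis vector, [one] the all-ones vector, and [sigma] the
    inverse of [tau], so that [T (outer (e r) (e s))] has its only nonzero entry
    at [sigma (r, s)], while [T (outer one one)] is the matrix [c]. Each of the
    facts [sigma_row], [betaE] and [cE] comes from one application of [RT]. *)
Lemma preserves_green_R_monomial (T : {linear 'M[S]_n -> 'M[S]_n}) :
    (forall Y, exists X, T X = Y) -> preserves T (@green_R S n) ->
  exists P Q : 'M[S]_n,
    [/\ invertible_mx P /\ monomial_mx P,
        invertible_mx Q /\ monomial_mx Q
      & forall X : 'M[S]_n, T X = P *m X *m Q].
Proof.
move=> surjT presT; have [c [tau [c_neq0 tau_inj TE]]] := linear_surj_monomial surjT.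
pose k0 : 'I_n := Ordinal n_gt0; pose e (s j : 'I_n) : S := (j == s)%:R.
pose one (j : 'I_n) : S := 1; pose sigma := invF tau_inj.
have e1 s : e s s = 1 by rewrite /e eqxx.
have RT u v w s : w s = 1 -> v k0 = 1 ->
  le_R (T (outer u v)) (T (outer u w)) /\ le_R (T (outer u w)) (T (outer u v)).
  by move=> ws vk; apply: presT; apply: green_R_outer vk ws.
have Touter u v i j :
    T (outer u v) i j = c i j * (u (tau (i, j)).1 * v (tau (i, j)).2).
  by rewrite TE mxE.
(* All rows of [T (outer (e r) (e s))], hence of its right multiple
   [T (outer (e r) one)], vanish except the one through [sigma (r, s)]. *)
have sigma_row r s i j : (tau (i, j)).1 = r -> i = (sigma (r, s)).1.
  move=> tau_r; apply/eqP; apply: contraT => i_neq.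
  have [[X TX] _] := RT (e r) one (e s) s (e1 s) erefl.
  have: T (outer (e r) one) i j = 0.
    rewrite TX mxE big1 // => k _; rewrite Touter /e.
    case: eqP => [tau1|]; last by rewrite !(mul0r, mulr0).
    case: eqP => [tau2|]; last by rewrite !(mul0r, mulr0).
    move: i_neq; rewrite -tau1 -tau2 -surjective_pairing /sigma invF_f /=.
    by rewrite eqxx.
  by rewrite Touter tau_r e1 !mulr1 => /eqP; rewrite (negPf (c_neq0 _ _)).
pose alpha i := (tau (i, k0)).1.
have alphaK : cancel alpha (fun r => (sigma (r, k0)).1).
  by move=> i; rewrite -(sigma_row _ k0 i k0).
have alphaE i j : (tau (i, j)).1 = alpha i.
  rewrite {2}(sigma_row _ k0 i j erefl).
  by rewrite (canF_sym alphaK).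
pose beta j := (tau (k0, j)).2.
have betaE i j : (tau (i, j)).2 = beta j.
  have [_ [X TX]] := RT one one (e (beta j)) _ (e1 _) erefl.
  (* [T (outer one (e (beta j))) = c *m X] with [c] nowhere zero, so one zero
     entry in a column of the product forces that column of [X] to be zero. *)
  have X_eq0 k : T (outer one (e (beta j))) k j = 0 -> forall l, X l j = 0.
    rewrite TX mxE => /anti_negative_sum_eq0 sum0 l.
    have:= sum0 l; rewrite Touter !mulr1 => /semifield_mulf_eq0; exact.
  apply/eqP; apply: contraT => tau_neq.
  have /X_eq0 X0 : T (outer one (e (beta j))) i j = 0.
    by rewrite Touter /e (negPf tau_neq) !mulr0.
  have: T (outer one (e (beta j))) k0 j = 0.
    by rewrite TX mxE big1 // => l _; rewrite X0 mulr0.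
  by rewrite Touter -/(beta j) e1 !mulr1 => /eqP; rewrite (negPf (c_neq0 _ _)).
have tauE i j : tau (i, j) = (alpha i, beta j).
  by rewrite [LHS]surjective_pairing alphaE betaE.
have beta_inj : injective beta.
  move=> j j' eq_beta; have: tau (k0, j) = tau (k0, j') by rewrite !tauE eq_beta.
  by case/tau_inj.
have [q cE] : exists q, forall i j, c i j = c i k0 * q j.
  have [[X TX] _] := RT one one (e (beta k0)) _ (e1 _) erefl.
  (* Only the column [k0] of [T (outer one (e (beta k0)))] is nonzero, so the
     product defining [c] reduces to this column times the row [k0] of [X]. *)
  exists (X k0) => i j; have := congr1 (fun A : 'M[S]_n => A i j) TX.
  rewrite Touter !mulr1 => ->; rewrite mxE (bigD1 k0) //= big1 => [|k k_neq].
    by rewrite Touter betaE e1 !mulr1 addr0.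
  by rewrite Touter betaE /e (inj_eq beta_inj) (negPf k_neq) !mulr0 mul0r.
have q_neq0 j : q j != 0.
  by apply: contraNneq (c_neq0 k0 j) => q0; rewrite cE q0 mulr0.
exists (scaled_perm_mx (c^~ k0) alpha), (scaled_perm_mx q beta)^T.
have alpha_inj := can_inj alphaK.
split.
- by split; [apply: invertible_scaled_perm_mx | apply: monomial_scaled_perm_mx].
- by split; [apply/invertible_mx_tr/invertible_scaled_perm_mx
            | apply/monomial_mx_tr/monomial_scaled_perm_mx].
move=> X; apply/matrixP=> i j.
by rewrite mul_mx_tr_scaled_perm_mx mul_scaled_perm_mx TE tauE cE /= mulrAC.
Qed.

End PreservesR.

(** * Transposition and multiplication by invertible matrices *)

Section Relations.

Variable n : nat.
Implicit Types A B P Q : 'M[S]_n.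

Lemma le_R_tr A B : le_R A^T B^T <-> le_L A B.
Proof.
split=> [[X]|[X ->]]; last by exists X^T; rewrite trmx_mul.
by move/(congr1 trmx); rewrite trmx_mul !trmxK => ->; exists X^T.
Qed.

Lemma green_R_tr A B : green_R A^T B^T <-> green_L A B.
Proof. by split=> -[? ?]; split; apply/le_R_tr. Qed.

(** [X |-> (T X^T)^T] preserves R whenever [T] preserves L, and transposing
    [P *m X^T *m Q] exchanges the two factors. *)
Lemma preserves_green_L_monomial (T : {linear 'M[S]_n -> 'M[S]_n}) :
    (0 < n)%N ->
    (forall Y, exists X, T X = Y) -> preserves T (@green_L S n) ->
  exists P Q : 'M[S]_n,
    [/\ invertible_mx P /\ monomial_mx P,
        invertible_mx Q /\ monomial_mx Q
      & forall X : 'M[S]_n, T X = P *m X *m Q].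
Proof.
move=> n_gt0 surjT presT.
pose T' : {linear 'M[S]_n -> 'M[S]_n} := trmx \o T \o trmx.
have surjT' Y : exists X, T' X = Y.
  by have [X TX] := surjT Y^T; exists X^T; rewrite /= trmxK TX trmxK.
have presT' : preserves T' (@green_R S n).
  move=> A B; rewrite -{1}[A]trmxK -{1}[B]trmxK => /green_R_tr AB.
  by apply/green_R_tr/presT.
have [P [Q [[invP monP] [invQ monQ] TE]]] :=
  preserves_green_R_monomial n_gt0 surjT' presT'.
exists Q^T, P^T; split.
- by split; [apply: invertible_mx_tr | apply: monomial_mx_tr].
- by split; [apply: invertible_mx_tr | apply: monomial_mx_tr].
move=> X; have /= := TE X^T; rewrite trmxK => /(congr1 trmx).
by rewrite trmxK !trmx_mul trmxK mulmxA.
Qed.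

(** If [A = B *m X] then [P *m A *m Q = (P *m B *m Q) *m (Q^-1 *m X *m Q)]. *)
Lemma preserves_le_R_equivalence (T : 'M[S]_n -> 'M[S]_n) P Q :
    invertible_mx Q -> (forall X, T X = P *m X *m Q) ->
  preserves T (@le_R S n).
Proof.
move=> [Q' [QQ' _]] TE A B [X ->]; exists (Q' *m X *m Q).
by rewrite !TE !mulmxA -[P *m B *m Q *m Q']mulmxA QQ' mulmx1.
Qed.

Lemma preserves_le_L_equivalence (T : 'M[S]_n -> 'M[S]_n) P Q :
    invertible_mx P -> (forall X, T X = P *m X *m Q) ->
  preserves T (@le_L S n).
Proof.
move=> [P' [_ P'P]] TE A B [X ->]; exists (P *m X *m P').
by rewrite !TE !mulmxA -[P *m X *m P' *m P]mulmxA P'P mulmx1.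
Qed.

Lemma preserves_green_R (T : 'M[S]_n -> 'M[S]_n) :
  preserves T (@le_R S n) -> preserves T (@green_R S n).
Proof. by move=> presT A B [AB BA]; split; apply: presT. Qed.

Lemma preserves_green_L (T : 'M[S]_n -> 'M[S]_n) :
  preserves T (@le_L S n) -> preserves T (@green_L S n).
Proof. by move=> presT A B [AB BA]; split; apply: presT. Qed.

End Relations.

End Semifield.

Theorem theorem3p5 (S : comNzSemiRingType)
    (semifieldS : semifield S) (anti_negS : anti_negative S)
    (n : nat) (n_gt0 : (0 < n)%N)
    (T : {linear 'M[S]_n -> 'M[S]_n}) (bijT : bijective T) :
  [<-> preserves T (@green_R S n);
       preserves T (@green_L S n);
       preserves T (@le_R S n);
       preserves T (@le_L S n);
       exists P Q : 'M[S]_n,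
         [/\ invertible_mx P /\ monomial_mx P,
             invertible_mx Q /\ monomial_mx Q
           & forall X : 'M[S]_n, T X = P *m X *m Q]].
Proof.
have surjT Y : exists X, T X = Y by have [U _ TU] := bijT; exists (U Y).
have fromR := preserves_green_R_monomial semifieldS anti_negS n_gt0 surjT.
have fromL := preserves_green_L_monomial semifieldS anti_negS n_gt0 surjT.
tfae.
- case/fromR=> P [Q [[invP _] _ TE]].
  exact/preserves_green_L/(preserves_le_L_equivalence invP TE).
- case/fromL=> P [Q [_ [invQ _] TE]].
  exact: preserves_le_R_equivalence invQ TE.
- case/preserves_green_R/fromR=> P [Q [[invP _] _ TE]].
  exact: preserves_le_L_equivalence invP TE.
- by move/preserves_green_L/fromL.
- case=> P [Q [_ [invQ _] TE]].
  exact/preserves_green_R/(preserves_le_R_equivalence invQ TE).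
Qed.
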